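(* Let $d\in\mathbb{N}$ be a depth constraint and $\mathit{xs}$ a data list. Suppose the objective function $E$ can be defined according to the recursive scheme $$E(\mathit{DL}(\mathit{ys}))=f(\mathit{ys}),\qquad E(\mathit{DN}(u,r,v))=g\big(E(\mathit{mapD}_{\cap r^{+}}(u)),\,E(\mathit{mapD}_{\cap r^{-}}(v))\big),\qquad g(a,b)\ge\max(a,b)$$ (i.e., objectives for which the monotonicity implication recalled in the context holds). Define recursively $\mathit{odt}_{\text{depth}}(0,\mathit{xs})=\mathit{DL}(\mathit{xs})$, $$\mathit{odt}_{\text{depth}}(1,\mathit{xs})=\mathit{min}_{E}\big[\mathit{DN}(\mathit{DL}(\mathit{xs}^{+}),r,\mathit{DL}(\mathit{xs}^{-}))\mid r\leftarrow\mathit{gen}_{\mathit{splits}}(\mathit{xs})\big],$$ and otherwise $$\mathit{odt}_{\text{depth}}(d,\mathit{xs})=\mathit{min}_{E}\big[\mathit{DN}(\mathit{odt}_{\text{depth}}(d-1,\mathit{xs}^{+}),r,\mathit{odt}_{\text{depth}}(d-1,\mathit{xs}^{-}))\mid r\leftarrow\mathit{gen}_{\mathit{splits}}(\mathit{xs})\big].$$ Then the solution obtained by $\mathit{odt}_{\text{depth}}$ is a solution of $\mathit{min}_{E}\circ\mathit{genDTDs}_{\text{depth}}(d)$, i.e. $$\mathit{odt}_{\text{depth}}(d)\subseteq\mathit{min}_{E}\circ\mathit{genDTDs}_{\text{depth}}(d),$$ where ''$\subseteq$'' means that the solution on the left is one of the solutions on the right (one of the trees generated by $\mathit{genDTDs}_{\text{depth}}$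 that are optimal with respect to $E$).
   Context: Data points lie in $\mathbb{R}^{D}$; a data list is a finite list of data points. A splitting rule $r$ subdivides the space into two disjoint connected regions $r^{+},r^{-}$. $\mathit{gen}_{\mathit{splits}}$ is a given function sending a data list to a list of splitting rules. $\mathit{DTree}$ is the inductive type of binary trees that are either a leaf $\mathit{DL}(\mathit{ys})$ carrying a data list $\mathit{ys}$, or a node $\mathit{DN}(u,r,v)$ with left subtree $u$, rule $r$ and right subtree $v$. For a data list $\mathit{ys}$ and a region $S$, $\mathit{ys}\cap S$ is the sublist of elements of $\mathit{ys}$ lying in $S$. For the rule $r$ bound in the same expression, $\mathit{xs}^{\pm}=\mathit{xs}\cap r^{\pm}$. $\mathit{mapD}_{\cap S}$ replaces the data list $\mathit{ys}$ in every leaf of a tree by $\mathit{ys}\cap S$, leaving rules and shape unchanged. The depth-constrained generator is: $\mathit{genDTDs}_{\text{depth}}(0,\mathit{xs})=[\mathit{DL}(\mathit{xs})]$, $\mathit{genDTDs}_{\text{depth}}(1,\mathit{xs})=[\mathit{DN}(\mathit{DL}(\mathit{xs}^{+}),r,\mathit{DL}(\mathit{xs}^{-}))\mid r\leftarrow\mathit{gen}_{\mathit{splits}}(\mathit{xs})]$, and otherwise $\mathit{genDTDs}_{\text{depth}}(d,\mathit{xs})$ is the list of all $\mathit{DN}(u,r,v)$ with $r$ from $\mathit{gen}_{\mathit{splits}}(\mathit{xs})$, $u$ from $\mathit{genDTDs}_{\text{depth}}(d-1,\mathit{xs}^{+})$ and $v$ from $\mathit{genDTDs}_{\text{depth}}(d-1,\mathit{xs}^{-})$.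 In the scheme for $E$, $f$ maps data lists to $\mathbb{R}$ and $g:\mathbb{R}\times\mathbb{R}\to\mathbb{R}$. Monotonicity implication, asserted in the paper to hold trivially for objectives of this scheme: for a common root $r$ and subtrees $u,u',v,v'$, $E(\mathit{mapD}_{\cap r^{+}}(u))\le E(\mathit{mapD}_{\cap r^{+}}(u'))$ and $E(\mathit{mapD}_{\cap r^{-}}(v))\le E(\mathit{mapD}_{\cap r^{-}}(v'))$ imply $E(\mathit{DN}(u,r,v))\le E(\mathit{DN}(u',r,v'))$. $\mathit{min}_{E}$ selects an optimal tree from a list: $\mathit{min}_E([a])=a$, and $\mathit{min}_E(a:\mathit{as})=a$ if $E(a)\le E(\mathit{min}_E(\mathit{as}))$, else $\mathit{min}_E(\mathit{as})$.
   Formalization: The monotonicity implication for E is assumed as a separate hypothesis, since g(a,b) ≥ max(a,b) alone does not imply it and the claim then fails; where no split is available, odt is treated as undefined, and is shown to be undefined only if no tree is generated. *)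

(* Defs.v *)
From HB Require Import structures.
From mathcomp Require Import all_boot all_order all_algebra.
From mathcomp Require Import all_classical all_reals all_analysis.
Import Order.TTheory GRing.Theory Num.Theory numFieldNormedType.Exports.

Set Implicit Arguments.
Unset Strict Implicit.
Unset Printing Implicit Defensive.

Local Open Scope classical_set_scope.
Local Open Scope ring_scope.

Definition data (R : realType) (D : nat) := seq 'rV[R]_D.

Record rule (R : realType) (D : nat) := Rule {
  pos : set 'rV[R]_D;
  neg : set 'rV[R]_D;
  rule_cover : pos `|` neg = setT;
  rule_disjoint : pos `&` neg = set0;
  rule_pos_connected : connected pos;
  rule_neg_connected : connected neg
}.

Inductive DTree (R : realType) (D : nat) : Type :=
| DL of data R D
| DN of DTree R D & rule R D & DTree R D.

(* Rules contain arbitrary sets, so equality of trees is only classically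
   decidable; it is used to write [t \in ts]. *)
HB.instance Definition _ (R : realType) (D : nat) := gen_eqMixin (rule R D).
HB.instance Definition _ (R : realType) (D : nat) := gen_eqMixin (DTree R D).

Definition restrict (R : realType) (D : nat) (S : set 'rV[R]_D)
    (ys : data R D) : data R D :=
  [seq y <- ys | y \in S].

Fixpoint mapD (R : realType) (D : nat) (S : set 'rV[R]_D) (t : DTree R D) :
    DTree R D :=
  match t with
  | DL ys => DL (restrict S ys)
  | DN u r v => DN (mapD S u) r (mapD S v)
  end.

Fixpoint genDTDs (R : realType) (D : nat)
    (gen_splits : data R D -> seq (rule R D)) (d : nat) (xs : data R D) :
    seq (DTree R D) :=
  match d with
  | 0 => [:: DL xs]
  | 1 => [seq DN (DL (restrict (pos r) xs)) r (DL (restrict (neg r) xs))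
           | r <- gen_splits xs]
  | d'.+1 =>
      flatten [seq [seq DN u r v
                     | u <- genDTDs gen_splits d' (restrict (pos r) xs),
                       v <- genDTDs gen_splits d' (restrict (neg r) xs)]
                | r <- gen_splits xs]
  end.

(* The value [None] marks the empty list, on which there is no minimum. *)
Fixpoint minE (R : realType) (D : nat) (E : DTree R D -> R)
    (ts : seq (DTree R D)) : option (DTree R D) :=
  match ts with
  | [::] => None
  | a :: ts' =>
      match minE E ts' with
      | None => Some a
      | Some b => Some (if E a <= E b then a else b)
      end
  end.

(* The minimum is partial, hence so is [odt]: [gen_splits] may return [::].  A
   rule one of whose two subproblems has no solution contributes no candidate,
   just as it contributes no tree to [genDTDs]; see [odtSS] for the case where
   all subproblems have solutions. *)
Fixpoint odt (R : realType) (D : nat)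
    (gen_splits : data R D -> seq (rule R D)) (E : DTree R D -> R)
    (d : nat) (xs : data R D) : option (DTree R D) :=
  match d with
  | 0 => Some (DL xs)
  | 1 => minE E
      [seq DN (DL (restrict (pos r) xs)) r (DL (restrict (neg r) xs))
        | r <- gen_splits xs]
  | d'.+1 => minE E
      (pmap (fun r =>
               match odt gen_splits E d' (restrict (pos r) xs),
                     odt gen_splits E d' (restrict (neg r) xs) with
               | Some u, Some v => Some (DN u r v)
               | _, _ => None
               end)
            (gen_splits xs))
  end.

Lemma odtSS (R : realType) (D : nat)
    (gen_splits : data R D -> seq (rule R D)) (E : DTree R D -> R)
    (d : nat) (xs : data R D) (o : data R D -> DTree R D) :
  {in gen_splits xs, forall r,
    odt gen_splits E d.+1 (restrict (pos r) xs) =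
      Some (o (restrict (pos r) xs)) /\
    odt gen_splits E d.+1 (restrict (neg r) xs) =
      Some (o (restrict (neg r) xs))} ->
  odt gen_splits E d.+2 xs =
    minE E [seq DN (o (restrict (pos r) xs)) r (o (restrict (neg r) xs))
             | r <- gen_splits xs].
Proof.
move=> odt_o; rewrite [LHS]/=; congr minE.
elim: (gen_splits xs) odt_o => //= r rs IHrs odt_o.
have [] := odt_o r (mem_head _ _); rewrite /= => -> -> /=.
by congr cons; apply: IHrs => s s_rs; apply: odt_o; rewrite in_cons s_rs orbT.
Qed.

(* [t] is one of the trees of [ts] that are optimal with respect to [E];
   [minE] returns just one of them. *)
Definition optimal (R : realType) (D : nat) (E : DTree R D -> R)
    (ts : seq (DTree R D)) (t : DTree R D) : Prop :=
  t \in ts /\ forall t', t' \in ts -> E t <= E t'.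

(* Main.v *)
(* Leaves of a tree generated from xs^+ only carry data lying in r^+, so mapD_{cap r^+}
   fixes such a tree.  On generated trees the monotonicity implication is therefore
   the usual one for dynamic programming: replacing each subtree by an
   optimal one for its subproblem does not increase E. *)

Require Import Defs.
From mathcomp Require Import all_boot all_order all_algebra.
From mathcomp Require Import all_classical all_reals all_analysis.
Import Order.TTheory GRing.Theory Num.Theory numFieldNormedType.Exports.

Local Open Scope classical_set_scope.
Local Open Scope ring_scope.

Lemma minE_None {R : realType} {D : nat} {E : DTree R D -> R}
    {ts : seq (DTree R D)} :
  minE E ts = None -> ts = [::].
Proof. by case: ts => //= a ts; case: minE. Qed.

(** The winner between the head and the minimum of the tail bounds the whole tail, by transitivity
    when the head wins. *)
Lemma minE_optimal {R : realType} {D : nat} {E : DTree R D -> R}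
    {ts : seq (DTree R D)} {t : DTree R D} :
  minE E ts = Some t -> optimal E ts t.
Proof.
elim: ts t => //= a ts IHts t.
case min_ts: (minE E ts) => [b|] [<-]; last first.
  rewrite (minE_None min_ts); split; first exact: mem_head.
  by move=> t'; rewrite inE => /eqP->.
have [b_ts b_min] := IHts b min_ts.
case: (lerP (E a) (E b)) => [le_ab|/ltW le_ba]; split.
- exact: mem_head.
- move=> t'; rewrite in_cons => /orP[/eqP->//|/b_min].
  exact: le_trans.
- by rewrite in_cons b_ts orbT.
- by move=> t'; rewrite in_cons => /orP[/eqP->//|/b_min].
Qed.

Lemma restrictC {R : realType} {D : nat} (S T : set 'rV[R]_D) (xs : data R D) :
  Defs.restrict S (Defs.restrict T xs) = Defs.restrict T (Defs.restrict S xs).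
Proof.
by rewrite /Defs.restrict -!filter_predI; apply: eq_filter => x /=; rewrite andbC.
Qed.

Lemma restrict_id {R : realType} {D : nat} (S : set 'rV[R]_D) (xs : data R D) :
  Defs.restrict S (Defs.restrict S xs) = Defs.restrict S xs.
Proof. exact: filter_id. Qed.

(** Depth one is no exception to the general recursion: at depth zero each side has a single tree,
    so each rule contributes a singleton. Induction on [d] then has one successor case. *)
Lemma genDTDsS {R : realType} {D : nat}
    (gen_splits : data R D -> seq (rule R D)) (d : nat) (xs : data R D) :
  genDTDs gen_splits d.+1 xs =
  flatten [seq [seq DN u r v
                 | u <- genDTDs gen_splits d (Defs.restrict (pos r) xs),
                   v <- genDTDs gen_splits d (Defs.restrict (neg r) xs)]
            | r <- gen_splits xs].
Proof. by case: d => //=; rewrite flatten_map1. Qed.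

(** Again depth one fits the general clause: [odt] never fails at depth zero, so [pmap] drops no
    rule. *)
Lemma odtS {R : realType} {D : nat}
    (gen_splits : data R D -> seq (rule R D)) (E : DTree R D -> R)
    (d : nat) (xs : data R D) :
  odt gen_splits E d.+1 xs =
  minE E (pmap (fun r =>
            match odt gen_splits E d (Defs.restrict (pos r) xs),
                  odt gen_splits E d (Defs.restrict (neg r) xs) with
            | Some u, Some v => Some (DN u r v)
            | _, _ => None
            end) (gen_splits xs)).
Proof.
by case: d => //=; congr minE; elim: (gen_splits xs) => //= r rs ->.
Qed.

Lemma genDTDsSP {R : realType} {D : nat}
    {gen_splits : data R D -> seq (rule R D)} {d : nat} {xs : data R D}
    {t : DTree R D} :
  t \in genDTDs gen_splits d.+1 xs <->
  exists r u v, [/\ r \in gen_splits xs,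
    u \in genDTDs gen_splits d (Defs.restrict (pos r) xs),
    v \in genDTDs gen_splits d (Defs.restrict (neg r) xs) & t = DN u r v].
Proof.
rewrite genDTDsS; split.
  case/flatten_mapP=> r r_xs /allpairsP[[u v] /= [u_gen v_gen ->]].
  by exists r, u, v.
case=> r [u [v [r_xs u_gen v_gen ->]]].
by apply/flatten_mapP; exists r => //; apply/allpairsP; exists (u, v).
Qed.

(** The hypothesis says that all of [xs] lies in [S]. It is inherited by both subproblems because
    restrictions commute, and at a leaf it is exactly what is needed. *)
Lemma mapD_genDTDs {R : realType} {D : nat}
    {gen_splits : data R D -> seq (rule R D)} {S : set 'rV[R]_D}
    {d : nat} {xs : data R D} {t : DTree R D} :
  Defs.restrict S xs = xs -> t \in genDTDs gen_splits d xs -> mapD S t = t.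
Proof.
elim: d xs t => [|d IHd] xs t S_xs; first by rewrite inE => /eqP-> /=; rewrite S_xs.
case/genDTDsSP=> r [u [v [_ u_gen v_gen ->]]] /=.
by rewrite (IHd _ _ _ u_gen) ?(IHd _ _ _ v_gen) // restrictC S_xs.
Qed.

Theorem theorem8 (R : realType) (D : nat)
    (gen_splits : data R D -> seq (rule R D))
    (E : DTree R D -> R) (f : data R D -> R) (g : R -> R -> R)
    (E_leaf : forall ys : data R D, E (DL ys) = f ys)
    (E_node : forall (u : DTree R D) (r : rule R D) (v : DTree R D),
      E (DN u r v) = g (E (mapD (pos r) u)) (E (mapD (neg r) v)))
    (g_ge_max : forall a b : R, Num.max a b <= g a b)
    (E_monotone : forall (r : rule R D) (u u' v v' : DTree R D),
      E (mapD (pos r) u) <= E (mapD (pos r) u') ->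
      E (mapD (neg r) v) <= E (mapD (neg r) v') ->
      E (DN u r v) <= E (DN u' r v'))
    (d : nat) (xs : data R D) :
  (forall t : DTree R D, odt gen_splits E d xs = Some t ->
     optimal E (genDTDs gen_splits d xs) t) /\
  (odt gen_splits E d xs = None -> genDTDs gen_splits d xs = [::]).
Proof.
(* The data list stays general, since the induction hypothesis is applied to both restrictions of
   [xs]. Both conjuncts are proved together: the [None] part is needed at smaller depth to find
   candidates. *)
elim: d xs => [|d IHd] xs.
  split=> // t [<-]; split; first exact: mem_head.
  by move=> t'; rewrite inE => /eqP->.
rewrite odtS; set cands := pmap _ _.
have candsP c : c \in cands -> c \in genDTDs gen_splits d.+1 xs.
  rewrite mem_pmap => /mapP[r r_xs].
  case odt_u: (odt _ _ _ (Defs.restrict (pos r) xs)) => [u|] //.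
  case odt_v: (odt _ _ _ (Defs.restrict (neg r) xs)) => [v|] // [->].
  apply/genDTDsSP; exists r, u, v; split=> //.
    by have [/(_ _ odt_u)[]] := IHd (Defs.restrict (pos r) xs).
  by have [/(_ _ odt_v)[]] := IHd (Defs.restrict (neg r) xs).
(* There is at most one candidate per occurrence of a rule in [gen_splits xs], yet each generated
   tree is matched or beaten by the candidate with the same root rule. *)
have cands_dominate t : t \in genDTDs gen_splits d.+1 xs ->
    exists2 c, c \in cands & E c <= E t.
  case/genDTDsSP=> r [u' [v' [r_xs u'_gen v'_gen ->]]].
  have [opt_u none_u] := IHd (Defs.restrict (pos r) xs).
  have [opt_v none_v] := IHd (Defs.restrict (neg r) xs).
  (* [None] would make the subproblem's list of trees empty, contradicting the membership of [u'];
     likewise for [v'] below. *)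
  case odt_u: (odt _ _ _ (Defs.restrict (pos r) xs)) opt_u none_u => [u|] opt_u none_u;
    last by rewrite none_u in u'_gen.
  case odt_v: (odt _ _ _ (Defs.restrict (neg r) xs)) opt_v none_v => [v|] opt_v none_v;
    last by rewrite none_v in v'_gen.
  have [u_gen u_min] := opt_u u erefl.
  have [v_gen v_min] := opt_v v erefl.
  exists (DN u r v).
    by rewrite mem_pmap; apply/mapP; exists r; rewrite // odt_u odt_v.
  (* [mapD] fixes all four subtrees, so the premises reduce to the optimality of [u] and [v]. *)
  apply: E_monotone.
    by rewrite (mapD_genDTDs (restrict_id _ _) u_gen)
               (mapD_genDTDs (restrict_id _ _) u'_gen) u_min.
  by rewrite (mapD_genDTDs (restrict_id _ _) v_gen)
             (mapD_genDTDs (restrict_id _ _) v'_gen) v_min.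
split=> [t /minE_optimal[t_cands t_min] | /minE_None cands0].
  split; first exact: candsP.
  by move=> t' /cands_dominate[c /t_min le_tc]; apply: le_trans.
(* Any generated tree would be dominated by some candidate, but there are none. *)
case gen: (genDTDs _ _ _) cands_dominate => [//|t ts] /(_ t (mem_head _ _))[c].
by rewrite cands0.
Qed.
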